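(* For every $n\in\mathbb{N}$ and every $a=(a_1,\ldots,a_n)\in[0,\infty[^n$, $f_{\mathrm{SMG}}(a)$ equals the maximum of the union of the following four (possibly empty) sets: $$ \Big\{a_k-\sum_{i\neq k}a_i : 1\le k\le n\Big\},\qquad \Big\{\tfrac12\Big(a_k-\sum_{i<k}a_i\Big) : 1\le k\le n-1\Big\}, $$ $$ \Big\{\tfrac13\Big(a_k-\sum_{i>k}a_i\Big) : 3\le k\le n\Big\},\qquad \Big\{\tfrac{a_k}{4} : 3\le k\le n-1\Big\}, $$ where all sums are over $i\in\{1,\ldots,n\}$ subject to the indicated condition, and where $$ f_{\mathrm{SMG}}(a):=\inf\Big\{\mathbb{E}|S_n| : (S_0,S_1,\ldots,S_n)\text{ is a submartingale or a supermartingale},\ \mathbb{E}|X_1|=a_1,\ldots,\mathbb{E}|X_n|=a_n\Big\}, $$ the infimum being over all processes $(X_1,\ldots,X_n)$ of real-valued random variables (on arbitrary probability spaces) with the indicated properties, and $S_k:=\sum_{i=1}^k X_i$ for $k\in\{0,\ldots,n\}$.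
   Context: $\mathbb{N}=\{1,2,3,\ldots\}$. For a process $(X_1,\ldots,X_n)$ of real-valued random variables, $S_k:=\sum_{i=1}^k X_i$ for $k\in\{0,\ldots,n\}$, so $S_0=0$. ''$(S_0,\ldots,S_n)$ is a submartingale'' is understood with respect to the natural filtration, i.e. the $X_i$ are integrable and $\mathbb{E}(X_i\mid X_1,\ldots,X_{i-1})\ge 0$ for every $i\in\{1,\ldots,n\}$ (in particular $\mathbb{E}X_1\ge 0$, since the process starts at $S_0=0$); supermartingale is the same with $\le 0$. Since everything depends only on the law of $(X_1,\ldots,X_n)$, the infimum can formally be taken over the set of probability measures $P$ on $\mathbb{R}^n$ under which the coordinate process $(X_1,\ldots,X_n)=\mathrm{id}_{\mathbb{R}^n}$ has the stated properties. A set indexed by an empty range of $k$ is empty, and empty sums are $0$. *)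

(* Defs.v *)
From HB Require Import structures.
From mathcomp Require Import all_boot all_order all_algebra.
From mathcomp Require Import all_classical all_reals all_analysis.

Set Implicit Arguments.
Unset Strict Implicit.
Unset Printing Implicit Defensive.

Import Order.TTheory GRing.Theory Num.Theory.
Import numFieldNormedType.Exports.

Local Open Scope classical_set_scope.
Local Open Scope ring_scope.

(* [Y] is a version of the conditional expectation E(X | G), for [G] a
   sub-sigma-algebra and [X] integrable. *)
Definition is_cond_expectation (d : measure_display) (T : measurableType d)
    (R : realType) (P : probability T R) (G : set_system T) (X Y : T -> R) :
    Prop :=
  [/\ preimage_set_system [set: T] Y measurable `<=` G,
      P.-integrable [set: T] (EFin \o Y) &
      forall A : set T, G A ->
        (\int[P]_(t in A) (Y t)%:E = \int[P]_(t in A) (X t)%:E)%E].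

(* Processes (X_1, ..., X_n) are indexed by ['I_n], so that [X i] is X_(i+1).
   [past X i] is the sigma-algebra generated by the [X j] with [j < i]; it is
   the trivial one for [i = 0]. *)
Definition past (d : measure_display) (T : measurableType d) (R : realType)
    (P : probability T R) (n : nat) (X : 'I_n -> {RV P >-> R}) (i : 'I_n) :
    set_system T :=
  <<s \bigcup_(j in [set j : 'I_n | (j < i)%N])
        preimage_set_system [set: T] (X j) measurable >>.

(* The partial sums (S_0, ..., S_n) of [X] form a submartingale (resp. a
   supermartingale) for the natural filtration, in terms of the increments.
   Conditional expectations of integrable variables always exist and are
   a.s. unique, so the choice of the version [Y] is immaterial. *)
Definition sums_submartingale (d : measure_display) (T : measurableType d)
    (R : realType) (P : probability T R) (n : nat)
    (X : 'I_n -> {RV P >-> R}) : Prop :=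
  forall i : 'I_n, P.-integrable [set: T] (EFin \o X i) /\
    exists2 Y : T -> R, is_cond_expectation P (past X i) (X i) Y &
      {ae P, forall t, 0 <= Y t}.

Definition sums_supermartingale (d : measure_display) (T : measurableType d)
    (R : realType) (P : probability T R) (n : nat)
    (X : 'I_n -> {RV P >-> R}) : Prop :=
  forall i : 'I_n, P.-integrable [set: T] (EFin \o X i) /\
    exists2 Y : T -> R, is_cond_expectation P (past X i) (X i) Y &
      {ae P, forall t, Y t <= 0}.

(* Taken in the extended reals, so that an infimum over the empty set would
   be [+oo]. *)
Definition fSMG (R : realType) (n : nat) (a : 'I_n -> R) : \bar R :=
  ereal_inf [set e : \bar R |
    exists (d : measure_display) (T : measurableType d) (P : probability T R)
           (X : 'I_n -> {RV P >-> R}),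
      [/\ sums_submartingale X \/ sums_supermartingale X,
          forall i : 'I_n, ('E_P[fun t => `|X i t|%R] = (a i)%:E)%E &
          e = ('E_P[fun t => `|\sum_(i < n) X i t|%R])%E ]].

(* With the index [k : 'I_n] standing for k + 1, the range 1 <= k <= n - 1
   becomes [k.+1 < n] and 3 <= k <= n becomes [2 <= k]. *)
Definition fSMG_candidates (R : realType) (n : nat) (a : 'I_n -> R) : set R :=
  [set a k - \sum_(i < n | i != k) a i | k in [set: 'I_n]] `|`
  [set 2^-1 * (a k - \sum_(i < n | (i < k)%N) a i)
    | k in [set k : 'I_n | (k.+1 < n)%N]] `|`
  [set 3^-1 * (a k - \sum_(i < n | (k < i)%N) a i)
    | k in [set k : 'I_n | (2 <= k)%N]] `|`
  [set a k / 4 | k in [set k : 'I_n | (2 <= k)%N && (k.+1 < n)%N]].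

Definition is_maximum (R : realType) (A : set R) (m : R) : Prop :=
  A m /\ ubound A m.

(* Main.v *)
(* Lower bound: for a submartingale, [E S_j^+ <= E S_n^+] and [E S_j >= 0] give
   [E |S_j| <= 2 E |S_n|]; the four families of bounds follow by writing [X_k]
   through [S_n], [S_k], [S_(k-1)] and the other increments.

   Upper bound: let [m] exceed all candidates and let [A_i = a_1 + ... + a_i].
   One builds a Markov chain with [S_i] in [{M_i, 0, - M_i}] and
   [E |S_i| = r_i := min (2 m, A_i, m + A_n - A_i)].  While [r] increases, mass
   is born symmetrically from [0]; while it decreases, only the negative mass is
   killed, which a submartingale may do.  Since [|r_i - r_(i-1)| <= a_i], the
   remaining part of [a_i] must be spent without changing [E |S_i|]: the values
   [+- M_(i-1)] jump to [+- M_i] with probability [1 - rho = M_(i-1) / M_i] and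
   to [0] otherwise, at cost [2 rho min (r_(i-1), r_i)].  So any
   [a_i < r_(i-1) + r_i] can be met exactly, and that the four families lie
   below [m] is just what these inequalities need.  Finally [r_n <= m]. *)

Require Import Defs.
From HB Require Import structures.
From mathcomp Require Import all_boot all_order all_algebra.
From mathcomp Require Import all_classical all_reals all_analysis.
From mathcomp Require Import measurable_realfun ring lra zify.

Set Implicit Arguments.
Unset Strict Implicit.
Unset Printing Implicit Defensive.

Import Order.TTheory GRing.Theory Num.Theory.
Import numFieldNormedType.Exports.

Local Open Scope ring_scope.

(** * The target profile [r] *)

Section Profile.
Variables (R : realFieldType) (n : nat) (a : nat -> R) (m : R).

Definition psum (i : nat) : R := \sum_(0 <= j < i) a j.

(** The sequence [r_i] of the overview, with [psum i] as [A_i]: the value aimed at for [E |S_i|]. *)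
Definition level (i : nat) : R :=
  Num.min (Num.min (2 * m) (psum i)) (m + psum n - psum i).

Hypothesis m_gt0 : 0 < m.
Hypothesis a_ge0 : forall i, 0 <= a i.
(** The four bounds place the four families of candidates strictly below [m], cleared of
    denominators. Strictness is what later yields [rho < 1]. *)
Hypothesis bound1 : forall k, (k < n)%N -> a k < m + psum n - a k.
Hypothesis bound2 : forall k, (k.+1 < n)%N -> a k < 2 * m + psum k.
Hypothesis bound3 : forall k, (2 <= k < n)%N ->
  a k < 3 * m + psum n - psum k.+1.
Hypothesis bound4 : forall k, (2 <= k)%N -> (k.+1 < n)%N -> a k < 4 * m.

Lemma psum0 : psum 0 = 0.
Proof. by rewrite /psum big_geq. Qed.

Lemma psumS i : psum i.+1 = psum i + a i.
Proof. by rewrite /psum big_nat_recr. Qed.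

Lemma psum_le i j : (i <= j)%N -> psum i <= psum j.
Proof.
elim: j => [|j IH]; first by rewrite leqn0 => /eqP ->.
by rewrite leq_eqVlt => /predU1P[->//|/IH h]; rewrite psumS ler_wpDr.
Qed.

Lemma psum_ge0 i : 0 <= psum i.
Proof. by rewrite -psum0 psum_le. Qed.

(** Trades the nested minimum for linear facts, so that later goals become case splits closed by
    [lra]. *)
Lemma levelP i : [\/ level i = 2 * m, level i = psum i |
    level i = m + psum n - psum i] /\
  [/\ level i <= 2 * m, level i <= psum i & level i <= m + psum n - psum i].
Proof.
rewrite /level; split.
  by case: (leP (2 * m) (psum i)) => _; case: leP => _; rewrite ?minEle;
    (try by constructor 1); (try by constructor 2); constructor 3.
by rewrite !ge_min !lexx !orbT.
Qed.

Lemma level_ge0 i : (i <= n)%N -> 0 <= level i.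
Proof.
move=> /psum_le h; have m0 := m_gt0.
have := psum_ge0 i; have := levelP i.
by move=> [[]->] *; lra.
Qed.

Lemma level0 : level 0 = 0.
Proof.
have m0 := m_gt0; have := levelP 0; have := psum_ge0 n; rewrite psum0.
by move=> ? [[]->] [] *; lra.
Qed.

Lemma level_end : level n <= m.
Proof. by have [_ []] := levelP n; lra. Qed.

(** Each term of the minimum moves by at most [a i] in one step, and a minimum inherits this. *)
Lemma levelS_diff i : `|level i.+1 - level i| <= a i.
Proof.
rewrite ler_norml; have := a_ge0 i; have := levelP i; have := levelP i.+1.
rewrite psumS => -[[]->] [? ? ?] [[]->] [? ? ?] ?; lra.
Qed.

(** The bounds match the pairs of terms that realize the minimum at [i] and [i.+1]: [2 * m] twice
    calls for [bound4], [psum] then [2 * m] for [bound2], [2 * m] then the last term for [bound3],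
    and [psum] then the last term for [bound1]. *)
Lemma level_sum_lt i : (i < n)%N -> 0 < level i -> a i < level i + level i.+1.
Proof.
move=> lt_in; have m0 := m_gt0; have := a_ge0 i.
have := levelP i; have := levelP i.+1.
have pin : psum i.+1 <= psum n by exact: psum_le.
have := psum_ge0 i; have b1 := bound1 lt_in.
case: i => [|[|i]] in lt_in pin b1 *; first by rewrite level0 ltxx.
(* [bound3] and [bound4] do not reach index 1, but [bound2] at index 0 puts [psum 1] below [2 * m],
   which excludes the cases that would call for them. *)
- have b2 : a 0 < 2 * m by have := bound2 lt_in; rewrite psum0 addr0.
  have b2' : (2 < n)%N -> a 1 < 2 * m + psum 1 by apply: bound2.
  rewrite psumS psumS psum0 add0r in pin b2' *.
  have [/b2' {}b2'|n1] := ltnP 2 n.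
    by move=> ? [[]->] [? ? ?] [[]->] [? ? ?] ?; lra.
  have nE : n = 2 by lia.
  have : psum n = a 0 + a 1 by rewrite nE !psumS psum0 add0r.
  by move=> ? ? [[]->] [? ? ?] [[]->] [? ? ?] ?; lra.
- set k := i.+2 in lt_in pin b1 *.
  have b3 : a k < 3 * m + psum n - psum k.+1 by apply: bound3.
  have [k1|k1] := ltnP k.+1 n.
    have b2 := bound2 k1; have b4 : a k < 4 * m by apply: bound4.
    rewrite psumS in pin b3 *.
    by move=> ? [[]->] [? ? ?] [[]->] [? ? ?] ?; lra.
  (* At the last index the third term of the next level is [m], so that level is not [2 * m], and
     the cases of [bound2] and [bound4] do not occur. *)
  have nE : n = k.+1 by lia.
  have : psum n = psum k + a k by rewrite nE psumS.
  rewrite psumS in pin b3 *.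
  by move=> ? ? [[]->] [? ? ?] [[]->] [? ? ?] ?; lra.
Qed.

(** Only a vanishing level is new: then [psum i = 0], the bounds keep [a i] below the two other
    terms, and the next level is [a i] itself. *)
Lemma level_sum i : (i < n)%N -> a i <= level i + level i.+1.
Proof.
move=> lt_in; have [li0|li0] := ltP 0 (level i); first exact/ltW/level_sum_lt.
have lge0 := level_ge0 (ltnW lt_in).
have pin := psum_le lt_in; have m0 := m_gt0; have p0 := psum_ge0 i.
have a0 := a_ge0 i; have b1 := bound1 lt_in.
have b2 : a i < 2 * m + psum i.
  have [/bound2//|ni] := ltnP i.+1 n.
  have pn : psum n = psum i + a i by rewrite -psumS; congr psum; lia.
  by rewrite pn in b1; lra.
rewrite psumS in pin; have := levelP i.+1; rewrite psumS.
move: (levelP i) lge0 li0.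
by move=> [[]->] [? ? ?] ? ? [[]->] [? ? ?]; lra.
Qed.

End Profile.

(** * Submartingales on a finite sample space *)

Section DiscreteProcess.
Variable R : realFieldType.
Implicit Types (X Y : nat -> nat -> R) (w f : nat -> R).

(** Measurability with respect to the first [i] increments, expressed as constancy on their common
    fibres. *)
Definition adapted X (i : nat) f : Prop :=
  forall k l, (forall j, (j < i)%N -> X j k = X j l) -> f k = f l.

Definition walk X (i k : nat) : R := \sum_(j < i) X j k.

(* A submartingale on the sample space [{0, ..., N - 1}], where the point [k]
   has mass [w k] and [Y i] is the conditional expectation of [X i] given
   [X j], [j < i]. *)
Record discrete_submartingale (n : nat) (a : nat -> R) (N : nat) w X Y : Prop :=
  DiscreteSubmartingale {
    mass_ge0 : forall k, 0 <= w k;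
    mass_sum : \sum_(k < N) w k = 1;
    abs_moment : forall i, (i < n)%N -> \sum_(k < N) w k * `|X i k| = a i;
    drift_adapted : forall i, (i < n)%N -> adapted X i (Y i);
    drift_ge0 : forall i, (i < n)%N -> forall k, 0 <= Y i k;
    drift_orth : forall i, (i < n)%N -> forall f, adapted X i f ->
      \sum_(k < N) w k * (f k * (X i k - Y i k)) = 0 }.

Lemma sum_divn_modn3 N (F : nat -> nat -> R) :
  \sum_(k < N * 3) F (k %/ 3)%N (k %% 3)%N = \sum_(k < N) \sum_(t < 3) F k t.
Proof.
elim: N => [|N IH]; first by rewrite !big_ord0.
have -> : (N.+1 * 3 = (N * 3).+3)%N by lia.
rewrite !big_ord_recr big_ord0 /= IH add0r -!addrA.
have e0 : ((N * 3) %/ 3)%N = N by lia.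
have e1 : ((N * 3).+1 %/ 3)%N = N by lia.
have e2 : ((N * 3).+2 %/ 3)%N = N by lia.
have r0 : ((N * 3) %% 3)%N = 0 by lia.
have r1 : ((N * 3).+1 %% 3)%N = 1 by lia.
have r2 : ((N * 3).+2 %% 3)%N = 2 by lia.
by rewrite e0 e1 e2 r0 r1 r2.
Qed.

Lemma walk_adapted X n : adapted X n (walk X n).
Proof. by move=> k l kl; apply: eq_bigr => j _; exact: kl. Qed.

Section Extension.
Variables (n : nat) (a : nat -> R) (N : nat) (w : nat -> R).
Variables (X Y : nat -> nat -> R) (c : R -> nat -> R) (T : nat -> R).
Hypothesis subX : discrete_submartingale n a N w X Y.
Hypothesis c_ge0 : forall k t, 0 <= c (walk X n k) t.
Hypothesis c_sum : forall k, \sum_(t < 3) c (walk X n k) t = 1.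
Hypothesis c_drift : forall k,
  0 <= \sum_(t < 3) c (walk X n k) t * (T t - walk X n k).
Hypothesis c_moment : \sum_(k < N) w k *
  (\sum_(t < 3) c (walk X n k) t * `|T t - walk X n k|) = a n.

(* The point [k] is split into [3 k], [3 k + 1] and [3 k + 2]. *)
Let w' k := w (k %/ 3)%N * c (walk X n (k %/ 3)%N) (k %% 3)%N.
Let X' j k := if (j < n)%N then X j (k %/ 3)%N
  else T (k %% 3)%N - walk X n (k %/ 3)%N.
Let Y' j k := if (j < n)%N then Y j (k %/ 3)%N
  else \sum_(t < 3) c (walk X n (k %/ 3)%N) t * (T t - walk X n (k %/ 3)%N).

Let sum_ext F : \sum_(k < N * 3) w' k * F (k %/ 3)%N (k %% 3)%N =
  \sum_(k < N) w k * \sum_(t < 3) c (walk X n k) t * F k t.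
Proof.
rewrite (sum_divn_modn3 N (fun k t => w k * c (walk X n k) t * F k t)).
by apply: eq_bigr => k _; rewrite mulr_sumr; under eq_bigr do rewrite -mulrA.
Qed.

Let sum_ext_old F : \sum_(k < N * 3) w' k * F (k %/ 3)%N =
  \sum_(k < N) w k * F k.
Proof.
rewrite (sum_ext (fun k _ => F k)); apply: eq_bigr => k _.
by rewrite -mulr_suml c_sum mul1r.
Qed.

(** The first [n] increments do not see which of the three children was chosen, so [3 * k] can
    represent its whole triple. *)
Let adapted_ext i f : (i <= n)%N -> adapted X' i f ->
  adapted X i (fun k => f (3 * k)%N) /\ forall k, f k = f (3 * (k %/ 3))%N.
Proof.
move=> lein fX; split=> [k l kl|k]; apply: fX => j ji;
  rewrite /X' (leq_trans ji lein).
  have -> : (3 * k %/ 3)%N = k by lia.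
  have -> : (3 * l %/ 3)%N = l by lia.
  exact: kl.
by congr X; lia.
Qed.

Let ext_adapted i f : (i <= n)%N -> adapted X i f ->
  adapted X' i (fun k => f (k %/ 3)%N).
Proof.
move=> lein fX k l kl; apply: fX => j ji.
by have := kl j ji; rewrite /X' (leq_trans ji lein).
Qed.

Let walk_ext k : walk X' n.+1 k = T (k %% 3)%N.
Proof.
rewrite /walk big_ord_recr /= {2}/X' ltnn.
rewrite (eq_bigr (fun j : 'I_n => X j (k %/ 3)%N)) ?subrKC //.
by move=> j _; rewrite /X' ltn_ord.
Qed.

(** One Markov step: from the value [x] of the walk, [c x t] is the probability of jumping to [T t].
    The drift of the new increment depends on the walk alone, hence is adapted. *)
Lemma discrete_submartingale_ext : exists N' w' X' Y',
  [/\ discrete_submartingale n.+1 a N' w' X' Y',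
      forall k, exists t, walk X' n.+1 k = T t &
      forall g : R -> R, \sum_(k < N') w' k * g (walk X' n.+1 k) =
        \sum_(k < N) w k * \sum_(t < 3) c (walk X n k) t * g (T t)].
Proof.
exists (N * 3)%N, w', X', Y'; split; last 2 first.
- by move=> k; exists (k %% 3)%N; exact: walk_ext.
- move=> g; under eq_bigr do rewrite walk_ext.
  exact: (sum_ext (fun _ t => g (T t))).
split.
- by move=> k; rewrite mulr_ge0 ?c_ge0 ?(mass_ge0 subX).
- under eq_bigr do rewrite -[w' _]mulr1.
  rewrite (sum_ext_old (fun=> 1)); under eq_bigr do rewrite mulr1.
  exact: mass_sum subX.
- move=> i; rewrite ltnS leq_eqVlt => /predU1P[->|lt_in].
    rewrite -[RHS]c_moment -(sum_ext (fun k t => `|T t - walk X n k|)).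
    by apply: eq_bigr => k _; rewrite /X' ltnn.
  rewrite -(abs_moment subX lt_in) -(sum_ext_old (fun k => `|X i k|)).
  by apply: eq_bigr => k _; rewrite /X' lt_in.
- move=> i; rewrite ltnS leq_eqVlt => /predU1P[->|lt_in].
    have := ext_adapted (leqnn n) (@walk_adapted X n).
    move=> h k l /h e; rewrite /Y' ltnn; cbn in e.
    by rewrite e.
  have := ext_adapted (ltnW lt_in) (drift_adapted subX lt_in).
  by move=> h k l /h e; rewrite /Y' lt_in.
- move=> i _ k; rewrite /Y'; case: ifP => [lt_in|_]; last exact: c_drift.
  exact: (drift_ge0 subX).
- move=> i; rewrite ltnS leq_eqVlt => /predU1P[->|lt_in] f.
    move=> /(adapted_ext (leqnn n))[_ fE].
    (* On each triple [f] is constant and factors out; what remains is the new increment minus its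
       mean [D k], which averages to zero. *)
    pose D k := \sum_(t < 3) c (walk X n k) t * (T t - walk X n k).
    pose G k t := f (3 * k)%N * (T t - walk X n k - D k).
    transitivity (\sum_(k < N * 3) w' k * G (k %/ 3)%N (k %% 3)%N).
      by apply: eq_bigr => k _; rewrite /G -fE /X' /Y' ltnn.
    rewrite (sum_ext G) big1 // /G => k _.
    under eq_bigr do rewrite mulrCA; rewrite -mulr_sumr.
    under eq_bigr do rewrite mulrBr.
    by rewrite sumrB -mulr_suml c_sum mul1r subrr !mulr0.
  move=> /(adapted_ext (ltnW lt_in))[fX fE].
  pose G k := f (3 * k)%N * (X i k - Y i k).
  transitivity (\sum_(k < N) w k * G k); last exact: (drift_orth subX lt_in fX).
  rewrite -(sum_ext_old G) /G.
  by apply: eq_bigr => k _; rewrite -fE /X' /Y' lt_in.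
Qed.

End Extension.
End DiscreteProcess.

(** * The symmetric-support Markov chain and its one-step moves *)

Section ThreePointWalk.
Variable R : realFieldType.

(* [p] and [q] are the contributions of the values [M] and [- M] to the first
   absolute moment of the walk. *)
Definition three_point_walk (n : nat) (a : nat -> R) (p q M : R) : Prop :=
  exists N w X Y, [/\ discrete_submartingale n a N w X Y,
    forall k, [\/ walk X n k = M, walk X n k = - M | walk X n k = 0] &
    forall g : R -> R, \sum_(k < N) w k * g (walk X n k) =
      p / M * g M + q / M * g (- M) + (1 - (p + q) / M) * g 0].

Lemma three_point_walk0 a M : three_point_walk 0 a 0 0 M.
Proof.
exists 1, (fun=> 1), (fun _ _ => 0), (fun _ _ => 0); split.
- by split=> //; rewrite big_ord1.
- by move=> k; constructor 3; rewrite /walk big_ord0.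
- by move=> g; rewrite big_ord1 /walk big_ord0; ring.
Qed.

(* The values [+- M] move to [+- M / (1 - rho)] or die at [0]; negative values
   are moreover killed with probability [1 - kappa], and new mass is born
   symmetrically from [0] with first moment [delta]. *)
Lemma three_point_walkS n a p q M rho kappa delta :
  three_point_walk n a p q M ->
  0 <= p -> 0 <= q -> 0 <= rho < 1 -> 0 <= kappa <= 1 -> 0 <= delta ->
  p + q + delta < M ->
  a n = delta + (1 - kappa) * q + 2 * rho * (p + kappa * q) ->
  exists2 M', M <= M' &
    three_point_walk n.+1 a (p + delta / 2) (kappa * q + delta / 2) M'.
Proof.
move=> [N [w [X [Y [subX XM law]]]]] p0 q0.
move=> /andP[rho0 rho1] /andP[k0 k1] d0 pqM an.
have M0 : 0 < M by lra.
(* [r] is the probability of surviving, and [r * M' = M] makes the outward jump of the survivors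
   compensate the deaths. *)
pose r := 1 - rho; have r0 : 0 < r by rewrite subr_gt0.
have r1 : r <= 1 by rewrite /r; lra.
pose M' := M / r.
have MM' : M <= M' by rewrite /M' ler_pdivlMr // ler_piMr // ltW.
have M'0 : 0 < M' by exact: lt_le_trans MM'.
pose P0 := 1 - (p + q) / M.
have P0M : M * P0 = M - (p + q) by rewrite /P0; field; rewrite gt_eqF.
have P00 : 0 < P0 by rewrite -(pmulr_rgt0 _ M0) P0M; lra.
(* [s] is the fraction of the mass [P0] at 0 that is born, fixed by [P0 * (s * M') = delta];
   [s <= 1] follows from [p + q + delta < M]. *)
pose s := delta / (M' * P0).
have M'P0 : 0 < M' * P0 by exact: mulr_gt0.
have s0 : 0 <= s by rewrite divr_ge0 // ltW.
have s1 : s <= 1.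
  rewrite ler_pdivrMr // mul1r (@le_trans _ _ (M * P0)) //; first by lra.
  by rewrite ler_wpM2r // ltW.
pose T t := nth 0 [:: 0; M'; - M'] t.
pose c x t := if x == M then nth 0 [:: 1 - r; r; 0] t
  else if x == - M then nth 0 [:: 1 - r * kappa; 0; r * kappa] t
  else nth 0 [:: 1 - s; s / 2; s / 2] t.
have rk0 : 0 <= r * kappa by rewrite mulr_ge0 // ltW.
have rk1 : r * kappa <= 1 by rewrite mulr_ile1 // ltW.
have cM t : c M t = nth 0 [:: 1 - r; r; 0] t by rewrite /c eqxx.
have cN t : c (- M) t = nth 0 [:: 1 - r * kappa; 0; r * kappa] t.
  by rewrite /c eqxx -subr_eq0 lt_eqF //; lra.
have c0 t : c 0 t = nth 0 [:: 1 - s; s / 2; s / 2] t.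
  by rewrite /c (lt_eqF M0) gt_eqF //; lra.
have sum3 (F : nat -> R) : \sum_(t < 3) F t = F 0 + F 1 + F 2.
  by rewrite !big_ord_recr big_ord0 /= add0r.
have rM' : r * M' = M by rewrite /M' mulrC divfK // gt_eqF.
have [||||N' [w' [X' [Y' [subX' X'T law']]]]] :=
  @discrete_submartingale_ext R n a N w X Y c T subX.
- move=> k t; case: (XM k) => ->; rewrite ?cM ?cN ?c0.
  + by case: t => [|[|[|[|t]]]] //=; lra.
  + by case: t => [|[|[|[|t]]]] //=; lra.
  + by case: t => [|[|[|[|t]]]] //=; lra.
- move=> k; case: (XM k) => ->; rewrite sum3 ?cM ?cN ?c0 /=; lra.
- move=> k; rewrite (sum3 (fun t => c (walk X n k) t * (T t - walk X n k))).
  case: (XM k) => ->; rewrite ?cM ?cN ?c0 /T /=.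
  + have -> : (1 - r) * (0 - M) + r * (M' - M) + 0 * (- M' - M) = r * M' - M.
      by ring.
    by rewrite rM' subrr.
  + have -> : (1 - r * kappa) * (0 - - M) + 0 * (M' - - M) +
       r * kappa * (- M' - - M) = M - kappa * (r * M') by ring.
    by rewrite rM' subr_ge0 ler_piMl // ltW.
  + by lra.
(* Costs: on the positive side deaths and outward jumps take [rho * p] each; the negative side takes
   [(1 - kappa) * q + 2 * rho * kappa * q]; births take [delta]. The sum is [a n]. *)
- rewrite (law (fun x => \sum_(t < 3) c x t * `|T t - x|)).
  rewrite !(sum3 (fun t => c _ t * `|T t - _|)) !cM !cN !c0 /T /= an.
  rewrite !sub0r !opprK !subr0 !normrN normr0 !(gtr0_norm M0) !(gtr0_norm M'0).
  rewrite (@ger0_norm _ (M' - M)) ?subr_ge0 //.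
  rewrite (@ler0_norm _ (- M' + M)); last lra.
  have -> : rho = 1 - r by rewrite /r; ring.
  have sE : P0 * (s * M') = delta.
    rewrite /s; field; apply/andP; split; rewrite gt_eqF //.
  rewrite -/P0 !mul0r !mulr0 !addr0 !add0r.
  have -> : P0 * (s / 2 * M' + s / 2 * M') = P0 * (s * M') by field.
  rewrite sE /M'; field; apply/andP; split; rewrite gt_eqF //.
exists M' => //; exists N', w', X', Y'; split=> //.
- move=> k; have [t ->] := X'T k; rewrite /T.
  by case: t => [|[|[|t]]] /=; rewrite ?nth_nil; [constructor 3|constructor 1|
    constructor 2|constructor 3].
- move=> g; rewrite law' (law (fun x => \sum_(t < 3) c x t * g (T t))).
  rewrite !(sum3 (fun t => c _ t * g (T t))) !cM !cN !c0 /T /= -/P0.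
  have e1 : p / M' = p / M * r.
    by rewrite /M'; field; apply/andP; split; rewrite gt_eqF.
  have e2 : q / M' = q / M * r.
    by rewrite /M'; field; apply/andP; split; rewrite gt_eqF.
  have e3 : delta / M' = P0 * s.
    by rewrite /s; field; apply/andP; split; rewrite gt_eqF.
  have -> : (p + delta / 2) / M' = p / M' + delta / M' / 2 by ring.
  have -> : (kappa * q + delta / 2) / M' = kappa * (q / M') + delta / M' / 2.
    by ring.
  have -> : (p + delta / 2 + (kappa * q + delta / 2)) / M' =
    p / M' + kappa * (q / M') + delta / M' by field; rewrite gt_eqF.
  rewrite e1 e2 e3 /P0; field; rewrite gt_eqF //.
Qed.

End ThreePointWalk.

(** * A walk whose absolute moments follow the profile *)

Section WalkOfLevel.
Variables (R : realFieldType) (n : nat) (a : nat -> R) (m : R).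
Hypothesis m_gt0 : 0 < m.
Hypothesis a_ge0 : forall i, 0 <= a i.
Hypothesis bound1 : forall k, (k < n)%N -> a k < m + psum a n - a k.
Hypothesis bound2 : forall k, (k.+1 < n)%N -> a k < 2 * m + psum a k.
Hypothesis bound3 : forall k, (2 <= k < n)%N ->
  a k < 3 * m + psum a n - psum a k.+1.
Hypothesis bound4 : forall k, (2 <= k)%N -> (k.+1 < n)%N -> a k < 4 * m.

Local Notation level := (level n a m).

(** Solves [2 * rho * y = x] for [rho], where [x] is the part of [a i] still to be spent and [y] the
    moment that can move. If [y = 0], division by zero gives [rho = 0], which is right since [x = 0]
    as well. *)
Let ratio_bound (x y : R) : 0 <= x -> 0 <= y -> (0 < y -> x < 2 * y) ->
  (y = 0 -> x = 0) -> 0 <= x / (2 * y) < 1 /\ 2 * (x / (2 * y)) * y = x.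
Proof.
move=> x0 y0 xy y0x; have [y_eq0|y_neq0] := eqVneq y 0.
  by rewrite y_eq0 (y0x y_eq0) mul0r !mulr0 lexx ltr01.
have y_gt0 : 0 < y by rewrite lt0r y_neq0.
split; last by field.
rewrite ltr_pdivrMr ?mulr_gt0 // mul1r xy // andbT.
by rewrite divr_ge0 // mulr_ge0.
Qed.

(** [2 * m < M] leaves room at 0 for births. The bounds on [p] keep it below the next level, so that
    killing negative mass alone can bring the moment down. The final alternative separates the
    symmetric phase from the descent along the last term of the minimum. *)
Lemma level_walk_invariant i : (i <= n)%N -> exists p q M,
  [/\ three_point_walk i a p q M, 2 * m < M,
      [/\ 0 <= p, 0 <= q, p <= m & p <= psum a i], p + q = level i &
      p = q \/ level i = m + psum a n - psum a i].
Proof.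
have m0 := m_gt0; elim: i => [_|i IH lt_in].
  exists 0, 0, (2 * m + 1); split=> //; first exact: three_point_walk0.
  - by lra.
  - by rewrite psum0 lexx ltW.
  - by rewrite addr0 level0.
  - by left.
have [p [q [M [W mM [p0 q0 pm pA] pq mode]]]] := IH (ltnW lt_in).
have ai := a_ge0 i.
have := levelS_diff n m a_ge0 i; rewrite ler_norml => /andP[lo hi].
have sum_le := level_sum m_gt0 a_ge0 bound1 bound2 bound3 bound4 lt_in.
have sum_lt := level_sum_lt m_gt0 a_ge0 bound1 bound2 bound3 bound4 lt_in.
have l0 := level_ge0 m_gt0 a_ge0 (ltnW lt_in).
have [cases [l2 lA lB]] := levelP n a m i.
have [cases' [l2' lA' lB']] := levelP n a m i.+1.
have Ai := psum_ge0 a_ge0 i.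
have AS := psumS a i; have Ain := psum_le a_ge0 lt_in.
have [up|down] := ltP (level i) (level i.+1).
  (* The last term of the minimum never increases, so a rising level belongs to the symmetric
     phase. *)
  have qp : p = q by case: mode => // mode; lra.
  have [rho01 rhoE] : 0 <= (a i - (level i.+1 - level i)) / (2 * level i) < 1 /\
    2 * ((a i - (level i.+1 - level i)) / (2 * level i)) * level i =
      a i - (level i.+1 - level i).
    by apply: ratio_bound => //; [lra|move=> /sum_lt; lra|move=> ?; lra].
  have [||||M' MM' W'] := three_point_walkS (kappa := 1)
    (delta := level i.+1 - level i) W p0 q0 rho01.
  - by rewrite ler01 lexx.
  - by lra.
  - by lra.
  - by rewrite mul1r pq rhoE; lra.
  exists (p + (level i.+1 - level i) / 2).
  exists (1 * q + (level i.+1 - level i) / 2), M'.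
  split=> //; [lra|split; lra|lra|left; lra].
have p_le : p <= level i.+1 by case: cases' => ->; lra.
(* The negative moment that must remain, reached with [kappa = q' / q]; if [q = 0] then [q' = 0]
   too, and [kappa] is 0 by convention. *)
pose q' := level i.+1 - p; have q'0 : 0 <= q' by rewrite subr_ge0.
have q'q : q' <= q by rewrite /q'; lra.
have kE : q' / q * q = q'.
  have [q_eq0|q_neq0] := eqVneq q 0; last by rewrite divfK.
  by apply: le_anti; rewrite q_eq0 mulr0 q'0 -q_eq0.
have k01 : 0 <= q' / q <= 1.
  rewrite divr_ge0 //=; have [q_eq0|q_neq0] := eqVneq q 0.
    by rewrite q_eq0 invr0 mulr0 ler01.
  by rewrite ler_pdivrMr ?mul1r // lt0r q_neq0.
have [rho01 rhoE] :
    0 <= (a i - (level i - level i.+1)) / (2 * level i.+1) < 1 /\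
    2 * ((a i - (level i - level i.+1)) / (2 * level i.+1)) * level i.+1 =
      a i - (level i - level i.+1).
  apply: ratio_bound; [lra|lra| |move=> ?; lra].
  by move=> /lt_le_trans/(_ down)/sum_lt; lra.
have [|||M' MM' W'] := three_point_walkS (delta := 0) W p0 q0 rho01 k01.
- by [].
- by lra.
- rewrite kE [p + q']addrC subrK rhoE mulrBl mul1r kE /q'; lra.
exists p, q', M'; rewrite kE mul0r !addr0 in W'; split=> //.
- by lra.
- by split=> //; lra.
- by rewrite /q'; lra.
(* A constant level preserves the current alternative; a strict fall is possible only onto the last
   term. *)
have [eq_l|neq_l] := eqVneq (level i.+1) (level i).
  by case: mode => mode; [left; rewrite /q'; lra|right; lra].
right; have {neq_l}lt_l : level i.+1 < level i by rewrite lt_neqAle neq_l.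
by case: cases' => // e; lra.
Qed.

Lemma exists_discrete_submartingale : exists N w X Y,
  discrete_submartingale n a N w X Y /\
  \sum_(k < N) w k * `|walk X n k| <= m.
Proof.
have m0 := m_gt0.
have [p [q [M [[N [w [X [Y [subX _ law]]]]] mM [p0 q0 _ _] pq _]]]] :=
  level_walk_invariant (leqnn n).
exists N, w, X, Y; split=> //; rewrite law normrN normr0 mulr0 addr0.
have M0 : 0 < M by lra.
by rewrite (gtr0_norm M0) !divfK ?gt_eqF // pq level_end.
Qed.

End WalkOfLevel.

(** * Realization on a probability space *)

Section DiscreteProbability.
Context {R : realType}.
Variables (w : nat -> R) (N : nat).
Hypothesis w_ge0 : forall k, 0 <= w k.
Hypothesis w_sum : \sum_(k < N) w k = 1.

Definition discrete_measure : set nat -> \bar R :=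
  msum (fun k => mscale (NngNum (w_ge0 k)) \d_k) N.

HB.instance Definition _ := Measure.on discrete_measure.

Let discrete_measure_setT : discrete_measure setT = 1%E.
Proof.
transitivity (\sum_(k < N) w k)%:E; last by rewrite w_sum.
rewrite /discrete_measure /= /msum -sumEFin; apply: eq_bigr => k _.
by rewrite /= /mscale /= diracT mule1.
Qed.

HB.instance Definition _ :=
  Measure_isProbability.Build _ _ _ discrete_measure discrete_measure_setT.

Definition discrete_probability : probability nat R := discrete_measure.

Let ge0_integral_discrete (A : set nat) (f : nat -> R) : (forall k, 0 <= f k) ->
  (\int[discrete_probability]_(k in A) (f k)%:E =
    (\sum_(k < N) w k * (\1_A (k : nat) * f k))%:E)%E.
Proof.
move=> f0; rewrite ge0_integral_measure_sum //=; last first.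
  by move=> k _; rewrite lee_fin.
rewrite -sumEFin; apply: eq_bigr => k _.
rewrite ge0_integral_mscale //=; last by move=> l _; rewrite lee_fin.
by rewrite integral_dirac // diracE indicE.
Qed.

Lemma integral_discrete (A : set nat) (f : nat -> R) :
  (\int[discrete_probability]_(k in A) (f k)%:E =
    (\sum_(k < N) w k * (\1_A (k : nat) * f k))%:E)%E.
Proof.
rewrite integralE.
rewrite (_ : (fun k => (f k)%:E)^\+ = fun k => (Num.max (f k) 0)%:E)%E;
    last first.
  by apply/funext => k; rewrite funeposE EFin_max.
rewrite (_ : (fun k => (f k)%:E)^\- = fun k => (Num.max (- f k) 0)%:E)%E;
    last first.
  by apply/funext => k; rewrite funenegE EFin_max.
rewrite !ge0_integral_discrete //; try by move=> k; rewrite le_max lexx orbT.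
rewrite -EFinB -sumrB; congr EFin; apply: eq_bigr => k _.
rewrite -!mulrBr; congr (_ * (_ * _)).
by case: (leP (f k) 0) => fk; case: (leP (- f k) 0) => fk'; lra.
Qed.

Lemma integrable_discrete (f : nat -> R) :
  discrete_probability.-integrable setT (EFin \o f).
Proof.
apply/integrableP; split=> //.
rewrite (eq_integral (fun k => (`|f k|)%:E)) //.
by rewrite integral_discrete ltry.
Qed.

End DiscreteProbability.

(** An alias that carries the measurability structure for every function on the discrete space
    [nat]. *)
Definition nat_fun (R : realType) (f : nat -> R) : nat -> R := f.

Fact nat_fun_measurable (R : realType) (f : nat -> R) :
  measurable_fun [set: nat] (nat_fun f).
Proof. by []. Qed.

HB.instance Definition _ (R : realType) (f : nat -> R) :=
  isMeasurableFun.Build _ _ nat R (nat_fun f) (nat_fun_measurable f).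

Section Realization.
Variables (R : realType) (n : nat) (a : nat -> R) (N : nat) (w : nat -> R).
Variables (X Y : nat -> nat -> R).
Hypothesis subX : discrete_submartingale n a N w X Y.

Local Notation P := (discrete_probability (mass_ge0 subX) (mass_sum subX)).

Let Xrv (i : 'I_n) : {RV P >-> R} := nat_fun (X i).

(** Saturated sets form a sigma-algebra that contains the generators. Conversely, a saturated set is
    a countable union of fibres, each a finite intersection of generators. *)
Lemma past_discreteP (i : 'I_n) (A : set nat) : past Xrv i A <->
  forall k l, (forall j, (j < i)%N -> X j k = X j l) -> A k -> A l.
Proof.
split.
  pose C := [set B : set nat | forall k l,
    (forall j, (j < i)%N -> X j k = X j l) -> B k -> B l]%classic.
  suff : (past Xrv i `<=` C)%classic by apply.
  apply: smallest_sub.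
    split=> //.
    - move=> B CB k l kl [_ nBk]; split=> // Bl; apply: nBk.
      by apply: CB Bl => j ji; rewrite kl.
    - by move=> F CF k l kl [m _ Fk]; exists m => //; exact: CF Fk.
  move=> _ [j /= ji [B _ <-]] k l kl /= [_ Bk]; split=> //.
  by have <- : Xrv j k = Xrv j l by exact: kl.
move=> satA.
pose G := (\bigcup_(j in [set j : 'I_n | (j < i)%N])
  preimage_set_system [set: nat] (Xrv j) measurable)%classic.
change (measurable (A : set (g_sigma_algebraType G))).
have -> : A = (\bigcup_(k in A) \bigcap_(j in [set j : 'I_n | (j < i)%N])
    (X j @^-1` [set X j k]))%classic.
  apply/seteqP; split=> [k Ak|l [k Ak kl]]; first by exists k.
  apply: satA Ak => j ji.
  have jn : (j < n)%N by exact: ltn_trans ji (ltn_ord i).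
  by rewrite (kl (Ordinal jn) ji).
apply: bigcup_measurable => k _.
apply: fin_bigcap_measurable => // j ji.
apply: sub_sigma_algebra; exists j => //; exists [set X j k]%classic => //.
by rewrite setTI.
Qed.

Lemma discrete_sums_submartingale : sums_submartingale Xrv.
Proof.
move=> i; split; first exact: integrable_discrete.
exists (Y i); last by apply: aeW => k; exact: (drift_ge0 subX).
split; last 1 first.
- move=> A /past_discreteP satA; rewrite !integral_discrete; congr EFin.
  apply/esym/eqP; rewrite -subr_eq0 -sumrB; apply/eqP.
  under eq_bigr do rewrite -!mulrBr.
  (* The indicator of a past event is adapted, so it may serve as the test function. *)
  apply: (drift_orth subX) => // k l kl.
  by rewrite !indicE; congr ((_ : bool)%:R); apply/idP/idP => /set_mem h;
    apply/mem_set; apply: satA h => j ji; rewrite kl.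
- move=> _ [B _ <-]; apply/past_discreteP => k l kl [_ Bk]; split=> //=.
  by rewrite -(drift_adapted subX (ltn_ord i) kl).
- exact: integrable_discrete.
Qed.

Lemma discrete_realization : exists (d : measure_display)
    (T : measurableType d) (P : probability T R) (X' : 'I_n -> {RV P >-> R}),
  [/\ sums_submartingale X',
      forall i : 'I_n, ('E_P[fun t => `|X' i t|%R] = (a i)%:E)%E &
      ('E_P[fun t => `|\sum_(i < n) X' i t|%R] =
        (\sum_(k < N) w k * `|walk X n k|)%R%:E)%E].
Proof.
exists _, nat, P, Xrv; split; first exact: discrete_sums_submartingale.
- move=> i; rewrite unlock integral_discrete -(abs_moment subX (ltn_ord i)).
  by congr EFin; apply: eq_bigr => k _; rewrite indicT mul1r.
- rewrite unlock integral_discrete.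
  by congr EFin; apply: eq_bigr => k _; rewrite indicT mul1r.
Qed.

End Realization.

(** * Lower bound *)

Section LowerBound.
Context d (T : measurableType d) (R : realType) (P : probability T R).
Variables (n : nat) (x : 'I_n -> T -> R).
Hypothesis x_int : forall i, P.-integrable setT (EFin \o x i).

Definition partial_sum (j : nat) (t : T) : R := \sum_(i < n | (i < j)%N) x i t.
Local Notation S := partial_sum.

(* Sub- and supermartingales both yield these hypotheses, the latter for
   [- X]. *)
Hypothesis x_ge0 : forall i, 0 <= \int[P]_t x i t.
Hypothesis x_ge0_on : forall (i : 'I_n) (j : nat), (j <= i)%N ->
  0 <= \int[P]_(t in [set t | 0 <= S j t]%classic) x i t.

Lemma integrable_sum_EFin (Q : pred 'I_n) (g : 'I_n -> T -> R) :
  (forall i, P.-integrable setT (EFin \o g i)) ->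
  P.-integrable setT (EFin \o (fun t => \sum_(i < n | Q i) g i t)).
Proof.
move=> g_int; rewrite (_ : _ \o _ = fun t => \sum_(i < n | Q i) (g i t)%:E)%E.
  by apply: integrable_sum => // i _; exact: g_int.
by apply/funext => t /=; rewrite sumEFin.
Qed.

Lemma Rintegral_sum (A : set T) (Q : pred 'I_n) (g : 'I_n -> T -> R) :
  measurable A -> (forall i, P.-integrable setT (EFin \o g i)) ->
  \int[P]_(t in A) (\sum_(i < n | Q i) g i t) =
  \sum_(i < n | Q i) \int[P]_(t in A) g i t.
Proof.
move=> mA g_int.
have gA i : P.-integrable A (EFin \o g i)
  by exact: (integrableS measurableT mA (@subsetT _ _) (g_int i)).
rewrite /Rintegral -[RHS]/(fine (\sum_(i < n | Q i) fine
  (\int[P]_(t in A) (g i t)%:E))%:E) -sumEFin; congr fine.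
under eq_integral do rewrite -sumEFin.
rewrite integral_sum //; apply: eq_bigr => i _.
by rewrite fineK //; apply: integrable_fin_num => //; exact: gA.
Qed.

Lemma integrable_partial_sum j : P.-integrable setT (EFin \o S j).
Proof. exact: integrable_sum_EFin. Qed.

Lemma integrable_norm_sum j : P.-integrable setT (EFin \o (fun t => `|S j t|)).
Proof. exact/integrable_norm/integrable_partial_sum. Qed.

Let A j := [set t | 0 <= S j t]%classic.

Let measurable_A j : measurable (A j).
Proof.
have /measurable_int/measurable_EFinP mS := integrable_partial_sum j.
rewrite -[A j]setTI (_ : A j = S j @^-1` `[0, +oo[)%classic; first exact: mS.
by apply/seteqP; split=> t /=; rewrite in_itv /= andbT.
Qed.

Lemma partial_sum_split j t : (j <= n)%N ->
  S n t = S j t + \sum_(i < n | (j <= i)%N) x i t.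
Proof.
move=> jn; rewrite /S (bigID (fun i : 'I_n => (i < j)%N)) /=.
by congr (_ + _); apply: eq_bigl => i; rewrite ltn_ord //= -leqNgt.
Qed.

(** As [E S_j >= 0], the integral of [|S j|] is at most twice that of [S j] over [A j]. The later
    increments have nonnegative integral over [A j], so [S n] may replace [S j] there. *)
Lemma norm_partial_sum_le j : (j <= n)%N ->
  \int[P]_t `|S j t| <= 2 * \int[P]_t `|S n t|.
Proof.
move=> jn; have mA := measurable_A j; have mC := measurableC mA.
have split_A (g : T -> R) : P.-integrable setT (EFin \o g) ->
    \int[P]_t g t = \int[P]_(t in A j) g t + \int[P]_(t in ~` A j) g t.
  move=> g_int; rewrite -(setvU (A j)) setUC Rintegral_setU // ?setUv //.
  by apply/disj_setPS => t [].
have on (g : T -> R) B : measurable B -> P.-integrable setT (EFin \o g) ->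
    P.-integrable B (EFin \o g).
  by move=> mB; exact: (integrableS measurableT mB (@subsetT _ _)).
have iS := integrable_partial_sum; have iN := integrable_norm_sum.
have e1 : \int[P]_(t in A j) `|S j t| = \int[P]_(t in A j) S j t.
  by apply: eq_Rintegral => t /set_mem; exact: ger0_norm.
have e2 : \int[P]_(t in ~` A j) `|S j t| = - \int[P]_(t in ~` A j) S j t.
  rewrite -mulN1r -RintegralZl //; last exact: on.
  apply: eq_Rintegral => t /set_mem /= /negP; rewrite -ltNge mulN1r => h.
  exact: ltr0_norm.
have e3 : 0 <= \int[P]_t S j t.
  by rewrite Rintegral_sum //; apply: sumr_ge0 => i _; exact: x_ge0.
have e4 : \int[P]_(t in A j) S j t <= \int[P]_(t in A j) S n t.
  have -> : \int[P]_(t in A j) S n t = \int[P]_(t in A j) S j t +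
      \sum_(i < n | (j <= i)%N) \int[P]_(t in A j) x i t.
    rewrite -Rintegral_sum // -RintegralD //; [|exact: on|].
      by apply: eq_Rintegral => t _; exact: partial_sum_split.
    by apply: on => //; exact: integrable_sum_EFin.
  by rewrite lerDl; apply: sumr_ge0 => i ji; exact: x_ge0_on.
have e5 : \int[P]_(t in A j) S n t <= \int[P]_(t in A j) `|S n t|.
  by apply: le_Rintegral => // [||t _]; [exact: on|exact: on|exact: ler_norm].
have e6 : 0 <= \int[P]_(t in ~` A j) `|S n t| by exact: Rintegral_ge0.
rewrite split_A // split_A // in e3 *; rewrite (split_A (fun t => `|S n t|)) //.
lra.
Qed.

(** Common frame of the four bounds, a pointwise triangle inequality integrated. A partial sum then
    costs 0 if it is [S 0], 1 if it is [S n], and 2 otherwise by [norm_partial_sum_le]; this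
    produces the factors 1 to 4. *)
Lemma abs_moment_le (k : 'I_n) (j l : nat) (Q : pred 'I_n) :
  (forall t, `|x k t| <= `|S j t| + `|S l t| + \sum_(i < n | Q i) `|x i t|) ->
  \int[P]_t `|x k t| <= \int[P]_t `|S j t| + \int[P]_t `|S l t| +
    \sum_(i < n | Q i) \int[P]_t `|x i t|.
Proof.
move=> xk; have iN := integrable_norm_sum.
have ix i : P.-integrable setT (EFin \o (fun t => `|x i t|)).
  exact: integrable_norm.
have iSS : P.-integrable setT (EFin \o (fun t => `|S j t| + `|S l t|)).
  exact: (integrableD measurableT (iN j) (iN l)).
have iQ := integrable_sum_EFin Q ix.
rewrite -Rintegral_sum // -!RintegralD //; apply: le_Rintegral => //.
exact: (integrableD measurableT iSS iQ).
Qed.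

Let x_diff (k : 'I_n) t : x k t = S k.+1 t - S k t.
Proof.
rewrite /S (bigD1 k) //= (eq_bigl (fun i : 'I_n => (i < k)%N)) ?addrK // => i.
by rewrite ltnS ltn_neqAle andbC.
Qed.

Let norm_sum0 : \int[P]_t `|S 0 t| = 0.
Proof.
rewrite (@eq_Rintegral _ _ _ P setT (fun=> 0)) ?Rintegral_cst ?mul0r // => t _.
by rewrite /S big_pred0 ?normr0.
Qed.

Lemma abs_moment_bound1 (k : 'I_n) : \int[P]_t `|x k t| <=
  \int[P]_t `|S n t| + \sum_(i < n | i != k) \int[P]_t `|x i t|.
Proof.
have -> : \int[P]_t `|S n t| = \int[P]_t `|S n t| + \int[P]_t `|S 0 t|.
  by rewrite norm_sum0 addr0.
have S0 t : `|S 0 t| = 0 by rewrite /S big_pred0 ?normr0.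
apply: abs_moment_le => t; rewrite S0 addr0.
have -> : x k t = S n t - \sum_(i < n | i != k) x i t.
  rewrite /S (bigD1 k) //= (eq_bigl (fun i => i != k)) ?addrK // => i.
  by rewrite ltn_ord.
by apply: le_trans (ler_normB _ _) _; rewrite lerD2l ler_norm_sum.
Qed.

Lemma abs_moment_bound2 (k : 'I_n) : \int[P]_t `|x k t| <=
  2 * \int[P]_t `|S n t| + \sum_(i < n | (i < k)%N) \int[P]_t `|x i t|.
Proof.
have S0 t : `|S 0 t| = 0 by rewrite /S big_pred0 ?normr0.
apply: le_trans (_ : _ <= \int[P]_t `|S k.+1 t| + \int[P]_t `|S 0 t| + _) _.
  apply: (@abs_moment_le _ _ _ (fun i : 'I_n => (i < k)%N)) => t.
  rewrite S0 addr0 x_diff.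
  by apply: le_trans (ler_normB _ _) _; rewrite lerD2l ler_norm_sum.
by rewrite norm_sum0 addr0 lerD2r; exact: norm_partial_sum_le.
Qed.

Lemma abs_moment_bound3 (k : 'I_n) : \int[P]_t `|x k t| <=
  3 * \int[P]_t `|S n t| + \sum_(i < n | (k < i)%N) \int[P]_t `|x i t|.
Proof.
apply: le_trans (_ : _ <= \int[P]_t `|S n t| + \int[P]_t `|S k t| + _) _.
  apply: (@abs_moment_le _ _ _ (fun i : 'I_n => (k < i)%N)) => t.
  (* [S k.+1] is recovered from [S n] by removing the later increments, which lowers its cost from 2
     to 1. *)
  rewrite x_diff (partial_sum_split t (ltn_ord k)).
  set u := S k.+1 t; set v := S k t; set s := \sum_(i < n | _) x i t.
  have -> : u - v = (u + s) - v - s by ring.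
  apply: le_trans (ler_normB _ _) _; rewrite lerD ?ler_norm_sum //.
  exact: ler_normB.
by rewrite lerD2r; have := norm_partial_sum_le (ltnW (ltn_ord k)); lra.
Qed.

Lemma abs_moment_bound4 (k : 'I_n) :
  \int[P]_t `|x k t| <= 4 * \int[P]_t `|S n t|.
Proof.
apply: le_trans (_ : _ <= \int[P]_t `|S k.+1 t| + \int[P]_t `|S k t| + _) _.
  apply: (@abs_moment_le _ _ _ pred0) => t.
  by rewrite x_diff big_pred0 // addr0 ler_normB.
rewrite big_pred0 // addr0.
have := norm_partial_sum_le (ltn_ord k).
by have := norm_partial_sum_le (ltnW (ltn_ord k)); lra.
Qed.

End LowerBound.

(** * From conditional drifts to integrals over past events *)

Section SubmartingaleLowerBound.
Context d (T : measurableType d) (R : realType) (P : probability T R).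
Variables (n : nat) (X : 'I_n -> {RV P >-> R}).

Lemma past_measurable (i : 'I_n) (A : set T) : past X i A -> measurable A.
Proof.
suff : (past X i `<=` @measurable d T)%classic by apply.
apply: smallest_sub; first exact: sigma_algebra_measurable.
by move=> _ [j _ [B mB <-]]; exact: measurable_funP.
Qed.

Lemma past_partial_sum (e : R) (i : 'I_n) (j : nat) : (j <= i)%N ->
  past X i [set t | 0 <= partial_sum (fun k t => e * X k t) j t]%classic.
Proof.
move=> ji.
pose G := (\bigcup_(j in [set j : 'I_n | (j < i)%N])
  preimage_set_system [set: T] (X j) measurable)%classic.
have mX (k : 'I_n) : (k < i)%N ->
    measurable_fun [set: g_sigma_algebraType G]
      (X k : g_sigma_algebraType G -> R).
  move=> ki _ B mB; apply: sub_sigma_algebra; exists k => //.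
  by exists B.
have mS : measurable_fun [set: g_sigma_algebraType G]
    (partial_sum (fun k t => e * X k t) j : g_sigma_algebraType G -> R).
  rewrite (_ : partial_sum _ _ = fun t => \sum_(k <- index_enum 'I_n)
      (if (k < j)%N then e * X k t else 0)); last first.
    by apply/funext => t; exact: big_mkcond.
  apply: measurable_sum => k; case: (ltnP k j) => kj;
    last exact: measurable_cst.
  by apply: measurable_funM => //; apply: mX; exact: leq_trans kj ji.
change (measurable
  ([set t | 0 <= partial_sum (fun k t => e * X k t) j t]%classic
  : set (g_sigma_algebraType G))).
rewrite -[X in measurable X]setTI (_ : [set t | _]%classic =
  (partial_sum (fun k t => e * X k t) j) @^-1` `[0, +oo[)%classic;
  first exact: mS.
by apply/seteqP; split=> t /=; rewrite in_itv /= andbT.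
Qed.

(* [e = 1] for submartingales and [e = -1] for supermartingales. *)
Variable e : R.
Hypothesis e_norm : `|e| = 1.
Hypothesis X_int : forall i, P.-integrable [set: T] (EFin \o X i).
Hypothesis X_drift : forall i, exists2 Y : T -> R,
  is_cond_expectation P (past X i) (X i) Y & {ae P, forall t, 0 <= e * Y t}.

Let x (i : 'I_n) (t : T) : R := e * X i t.

Let x_int i : P.-integrable setT (EFin \o x i).
Proof.
rewrite (_ : _ \o _ = fun t => e%:E * (X i t)%:E)%E.
  by apply: integrableZl => //; exact: X_int.
by apply/funext => t; rewrite /= EFinM.
Qed.

(** Over a past event [X i] and its conditional expectation [Y] have the same integral, and [e * Y]
    is almost surely nonnegative. *)
Let x_past_ge0 i (A : set T) : past X i A -> 0 <= \int[P]_(t in A) x i t.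
Proof.
move=> pA; have mA := past_measurable pA.
have iA (f : T -> R) : P.-integrable setT (EFin \o f) ->
    P.-integrable A (EFin \o f).
  exact: (integrableS measurableT mA (@subsetT _ _)).
have [Y [_ Y_int YX] Y_ge0] := X_drift i.
rewrite RintegralZl //; last exact: iA.
rewrite /Rintegral -(YX _ pA) -[fine _]/(\int[P]_(t in A) Y t).
rewrite -RintegralZl //; last exact: iA.
rewrite /Rintegral fine_ge0 //.
have mY : measurable_fun A (fun t => (e * Y t)%:E).
  have /measurable_int := iA _ Y_int.
  by move=> /measurable_EFinP mY;
    apply/measurable_EFinP; apply: measurable_funM.
(* The sign holds only almost everywhere, so the integrand is replaced by its absolute value, which
   is nonnegative at every point. *)
rewrite (@ae_eq_integral _ _ _ P A (fun t => (`|e * Y t|)%:E)) //.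
- by apply: integral_ge0 => t _; rewrite lee_fin.
- apply/measurable_EFinP; apply: measurableT_comp => //.
  exact/measurable_EFinP.
- by apply: filterS Y_ge0 => t h _; rewrite ger0_norm.
Qed.

Let x_ge0 i : 0 <= \int[P]_t x i t.
Proof.
apply: x_past_ge0.
by rewrite -setC0; apply: sigma_algebraC; exact: sigma_algebra0.
Qed.

Let x_ge0_on (i : 'I_n) (j : nat) : (j <= i)%N ->
  0 <= \int[P]_(t in [set t | 0 <= partial_sum x j t]%classic) x i t.
Proof. by move=> ji; apply: x_past_ge0; exact: past_partial_sum. Qed.

Variable a : 'I_n -> R.
Hypothesis X_moment : forall i, ('E_P[fun t => `|X i t|%R] = (a i)%:E)%E.

Let a_moment i : \int[P]_t `|x i t| = a i.
Proof.
have := X_moment i; rewrite unlock /Rintegral => h.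
rewrite -[RHS]/(fine (a i)%:E) -h; congr fine.
by apply: eq_integral => t _; rewrite normrM e_norm mul1r.
Qed.

Let sumE t : `|\sum_(i < n) X i t| = `|partial_sum x n t|.
Proof.
rewrite /partial_sum [in RHS](eq_bigl xpredT) ; last first.
  by move=> i; rewrite /= ltn_ord.
by rewrite -mulr_sumr normrM e_norm mul1r.
Qed.

Lemma candidate_le_moment (c : R) : fSMG_candidates a c ->
  (c%:E <= 'E_P[fun t => `|\sum_(i < n) X i t|%R])%E.
Proof.
have -> : ('E_P[fun t => `|\sum_(i < n) X i t|%R] =
    (\int[P]_t `|partial_sum x n t|)%:E)%E.
  rewrite unlock /Rintegral fineK; last first.
    by apply: integrable_fin_num => //; exact: integrable_norm_sum.
  by apply: eq_integral => t _; rewrite sumE.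
rewrite lee_fin => -[[[]|]|] [k kP <-].
- have := abs_moment_bound1 x_int k.
  by rewrite a_moment (eq_bigr a) // => h; rewrite lerBlDr.
- have := abs_moment_bound2 x_int x_ge0 x_ge0_on k.
  by rewrite a_moment (eq_bigr a) //; lra.
- have := abs_moment_bound3 x_int x_ge0 x_ge0_on k.
  by rewrite a_moment (eq_bigr a) //; lra.
- have := abs_moment_bound4 x_int x_ge0 x_ge0_on k.
  by rewrite a_moment; lra.
Qed.

End SubmartingaleLowerBound.

(** * Existence of the maximum and comparison with the infimum *)

Lemma fSMG_candidates_max (R : realType) (n : nat) (a : 'I_n -> R) :
  (0 < n)%N -> exists m, is_maximum (fSMG_candidates a) m.
Proof.
move=> n_gt0.
have : finite_set (fSMG_candidates a).
  by rewrite /fSMG_candidates !finite_setU; do !split; exact: finite_image.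
move=> /finite_seqP[s sE].
have s_neq0 : s != [::].
  apply: contraTneq isT => s0; suff : (fSMG_candidates a !=set0)%classic.
    by rewrite sE s0 => -[? /=].
  by eexists; do 3 left; exists (Ordinal n_gt0).
suff [m ms sm] : exists2 m, m \in s & forall y, y \in s -> y <= m.
  by exists m; split; [rewrite sE|move=> y; rewrite sE; exact: sm].
elim: s s_neq0 {sE} => // y [_ _|z s IH _].
  by exists y => [|u]; rewrite mem_seq1 => // /eqP ->.
have [m ms sm] := IH isT; have [ym|my] := leP y m.
  by exists m => [|u]; rewrite inE ?ms ?orbT // => /predU1P[->|/sm].
exists y => [|u]; rewrite inE ?eqxx // => /predU1P[->//|/sm um].
by rewrite (le_trans um) // ltW.
Qed.

(** The first index suffices: it gives the candidate [a_1 / 2] if [n > 1] and [a_1] if [n = 1]. This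
    makes [m + e] positive in the construction. *)
Lemma fSMG_candidates_max_ge0 (R : realType) (n : nat) (a : 'I_n -> R) (m : R) :
  (0 < n)%N -> (forall i, 0 <= a i) -> is_maximum (fSMG_candidates a) m ->
  0 <= m.
Proof.
move=> n_gt0 a_ge0 [_ m_ub].
pose k := Ordinal n_gt0; have ak := a_ge0 k; have [n1|n1] := ltnP 1 n.
  have : fSMG_candidates a (2^-1 * (a k - \sum_(i < n | (i < k)%N) a i)).
    by do 2 left; right; exists k.
  by move=> /m_ub; rewrite big_pred0 //; lra.
have : fSMG_candidates a (a k - \sum_(i < n | i != k) a i).
  by do 3 left; exists k.
move=> /m_ub; rewrite big_pred0; first by lra.
move=> i; apply/negbTE; rewrite negbK; apply/eqP/val_inj => /=.
by have := ltn_ord i; lia.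
Qed.

Theorem theorem1p2 (R : realType) (n : nat) (a : 'I_n -> R)
    (n_gt0 : (0 < n)%N) (a_ge0 : forall i : 'I_n, 0 <= a i) :
  exists2 m : R, is_maximum (fSMG_candidates a) m & fSMG a = m%:E.
Proof.
have [m m_max] := fSMG_candidates_max a n_gt0.
have m_ge0 := fSMG_candidates_max_ge0 n_gt0 a_ge0 m_max.
exists m => //; have [m_cand m_ub] := m_max.
apply: le_anti; apply/andP; split; last first.
  apply: le_ereal_inf_tmp => _ [d [T [P [X [XX Xa ->]]]]].
  case: XX => XX.
    apply: (@candidate_le_moment d T R P n X 1) => //; first exact: normr1.
      by move=> i; have [] := XX i.
    move=> i; have [_ [Y XY Y0]] := XX i; exists Y => //.
    by apply: filterS Y0 => t; rewrite mul1r.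
  apply: (@candidate_le_moment d T R P n X (-1)) => //.
  - by rewrite normrN normr1.
  - by move=> i; have [] := XX i.
  - move=> i; have [_ [Y XY Y0]] := XX i; exists Y => //.
    by apply: filterS Y0 => t; rewrite mulN1r oppr_ge0.
(* The construction requires a level strictly above all candidates, hence [m + e] with arbitrary
   [e > 0]. *)
apply/lee_addgt0Pr => e e_gt0; rewrite -EFinD.
(* [b] extends [a] by 0 past the last index, as the discrete construction indexes moments by
   [nat]. *)
pose b j := oapp a 0 (insub j : option 'I_n).
have bE (i : 'I_n) : b i = a i by rewrite /b valK.
have b_ge0 j : 0 <= b j by rewrite /b; case: insubP => //= i; rewrite a_ge0.
have psumE j : (j <= n)%N -> psum b j = \sum_(i < n | (i < j)%N) a i.
  move=> jn; rewrite /psum (big_nat_widen _ _ _ _ _ jn) big_mkord.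
  by apply: eq_bigr => i _; rewrite bE.
have psum_n : psum b n = \sum_(i < n) a i.
  by rewrite psumE //; apply: eq_bigl => i; rewrite ltn_ord.
have [||k kn|k kn|k /andP[k2 kn]|k k2 kn|N [w [Y [Z [subY Ym]]]]] :=
    @exists_discrete_submartingale R n b (m + e).
- by rewrite ltr_wpDl.
- by [].
- have : fSMG_candidates a
      (a (Ordinal kn) - \sum_(i < n | i != Ordinal kn) a i).
    by do 3 left; exists (Ordinal kn).
  have := psum_n; rewrite (bigD1 (Ordinal kn)) //= => ->.
  by move=> /m_ub; rewrite -(bE (Ordinal kn)) /=; lra.
- have kn' := ltnW kn.
  have : fSMG_candidates a (2^-1 *
      (a (Ordinal kn') - \sum_(i < n | (i < k)%N) a i)).
    by do 2 left; right; exists (Ordinal kn').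
  by move=> /m_ub; rewrite psumE 1?ltnW // -(bE (Ordinal kn')) /=; lra.
- have : fSMG_candidates a (3^-1 *
      (a (Ordinal kn) - \sum_(i < n | (k < i)%N) a i)).
    by left; right; exists (Ordinal kn).
  have := psum_n; rewrite (bigID (fun i : 'I_n => (i < k.+1)%N)) /=.
  rewrite [X in _ = _ + X](eq_bigl (fun i : 'I_n => (k < i)%N)); last first.
    by move=> i; rewrite -leqNgt.
  by move=> -> /m_ub; rewrite psumE // -(bE (Ordinal kn)) /=; lra.
- have kn' := ltnW kn.
  have : fSMG_candidates a (a (Ordinal kn') / 4).
    by right; exists (Ordinal kn') => //=; rewrite k2.
  by move=> /m_ub; rewrite -(bE (Ordinal kn')) /=; lra.
have [d [T [P [X [subX Xa Xs]]]]] := discrete_realization subY.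
(* Submartingales alone already come within [e] of the maximum. *)
apply: ge_ereal_inf; exists (\sum_(k < N) w k * `|walk Y n k|)%R%:E; last first.
  by rewrite lee_fin.
by exists d, T, P, X; split => [|i|//]; [left|rewrite Xa bE].
Qed.
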